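(* Let $G$ be a connected graph of order $n\ge 270$. If $NC(G)\ge \frac{n}{2}$, then $G$ has a HIST if and only if $G$ does not have a pendant vertex which is adjacent to a vertex of degree $2$.
   Context: All graphs are finite and simple. The order of a graph is its number of vertices. $N(v)$ is the set of neighbors of $v$. A pendant vertex is a vertex of degree $1$. For a connected graph $G$, $NC(G):=\min\{|N(u)\cup N(v)| : uv\notin E(G),\ u\ne v\}$; a lower bound $NC(G)\ge c$ means that $|N(u)\cup N(v)|\ge c$ for every pair of distinct nonadjacent vertices $u,v$ (so it holds vacuously for complete graphs). A homeomorphically irreducible spanning tree (HIST) of a connected graph $G$ is a spanning tree of $G$ with no vertex of degree $2$ (degree taken in the tree). *)

(* Defs.v *)
(* Mathematical Components. A finite simple graph is a symmetric irreflexive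
   relation on a finType (its vertex set). *)
From mathcomp Require Import all_boot all_order all_algebra.

Set Implicit Arguments.
Unset Strict Implicit.
Unset Printing Implicit Defensive.

Definition simple_graph (T : finType) (e : rel T) : Prop :=
  symmetric e /\ irreflexive e.

Definition connected_graph (T : finType) (e : rel T) : Prop :=
  forall x y : T, connect e x y.

(* For a symmetric e, ucycle e [:: x; y] holds for every edge xy; the cycles
   of a simple graph are the ucycles with at least 3 vertices. *)
Definition acyclic_graph (T : finType) (e : rel T) : Prop :=
  forall c : seq T, ucycle e c -> size c < 3.

Definition tree (T : finType) (e : rel T) : Prop :=
  [/\ simple_graph e, connected_graph e & acyclic_graph e].

Definition spanning_tree (T : finType) (e t : rel T) : Prop :=
  tree t /\ subrel t e.

Definition nbhd (T : finType) (e : rel T) (v : T) : {set T} :=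
  [set w | e v w].

Definition degree (T : finType) (e : rel T) (v : T) : nat := #|nbhd e v|.

Definition pendant (T : finType) (e : rel T) (v : T) : Prop := degree e v = 1.

(* The lower bound NC(G) >= c; vacuous for complete graphs, for which the
   minimum is over the empty set. *)
Definition NC_ge (T : finType) (e : rel T) (c : rat) : Prop :=
  forall u v : T, u != v -> ~~ e u v ->
    (c <= #|nbhd e u :|: nbhd e v|%:R)%R.

Definition is_HIST (T : finType) (e t : rel T) : Prop :=
  spanning_tree e t /\ forall v : T, degree t v <> 2.

Definition has_HIST (T : finType) (e : rel T) : Prop :=
  exists t : rel T, is_HIST e t.

(* Main.v *)
(** Call a vertex low if its degree is less than n/4 and high otherwise. The
    condition on NC makes the low vertices a clique, shows that a high vertex not
    adjacent to a given low vertex a has more than n/4 high neighbours, and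
    implies that the graph induced by the high vertices has at most two components
    as soon as there is a low vertex.

    A HIST is obtained from a connected dominating set I whose members can be given
    pairwise disjoint pairs of private neighbours outside I: take a spanning tree
    of I and attach every other vertex as a leaf, the private ones to their owners.
    If all members of I are high, private neighbours can be chosen greedily when
    3|I| is at most about n/4. Such an I is grown greedily. If W is the set of high
    vertices not yet dominated, either some dominated vertex has many neighbours in
    W, or, since all degrees are at least about n/4, some vertex of W has so many
    neighbours in W that it pays to add it with the one or two vertices needed to
    connect it. For n >= 270 the worst case of this trade-off stays within the
    budget n/12.

    Low vertices cannot be given private neighbours greedily, so they enter I only
    through a small initial tree in which they already have degree at least 3: one
    low vertex if it sees every component of the high vertices, two adjacent ones
    if each sees only one of the two components (there are then at least four low
    vertices). If all low vertices have degree at most 2, there are at most two of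
    them, the high vertices induce a connected graph, and the low vertices become
    leaves; this fails only for a pendant vertex whose neighbour has degree 2. *)
Require Import Defs.
From Stdlib Require Import NArith.
From mathcomp Require Import all_boot all_order all_algebra zify.

Set Implicit Arguments.
Unset Strict Implicit.
Unset Printing Implicit Defensive.

(** * Growing trees *)

Section Trees.
Variables (T : finType) (e : rel T).
Hypotheses (e_sym : symmetric e) (e_irr : irreflexive e).

Definition add_edge (t : rel T) (u v : T) : rel T :=
  fun x y => [|| t x y, (x == u) && (y == v) | (x == v) && (y == u)].

(** Trees are grown by hanging one leaf at a time. The vertex set is an index because a tree on part
    of [T] is still a relation on all of [T]. *)
Inductive built : {set T} -> rel T -> Prop :=
| Built1 x : built [set x] (fun _ _ => false)
| BuiltS S t u v : built S t -> u \in S -> v \notin S -> e u v ->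
    built (v |: S) (add_edge t u v).

Lemma built_supp S t x y : built S t -> t x y -> (x \in S) && (y \in S).
Proof.
move=> b; elim: b x y => {S t} [//|S t u v _ IH uS vS euv] x y.
rewrite /add_edge !inE => /or3P[/IH/andP[-> ->]|/andP[/eqP-> /eqP->]|/andP[/eqP-> /eqP->]].
- by rewrite !orbT.
- by rewrite uS eqxx orbT.
- by rewrite uS eqxx orbT.
Qed.

Lemma built_sub S t : built S t -> subrel t e.
Proof.
elim=> {S t} [//|S t u v _ IH uS vS euv] x y.
by case/or3P=> [/IH //|/andP[/eqP-> /eqP->] //|/andP[/eqP-> /eqP->]]; rewrite e_sym.
Qed.

Lemma built_sym S t : built S t -> symmetric t.
Proof.
elim=> {S t} [//|S t u v _ IH uS vS euv] x y.
by rewrite /add_edge IH [(x == v) && _]andbC [(x == u) && _]andbC; congr orb; rewrite orbC.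
Qed.

Lemma built_simple S t : built S t -> simple_graph t.
Proof.
move=> b; split; first exact: built_sym b.
by move=> x; apply: negbTE; apply/negP => /(built_sub b); rewrite e_irr.
Qed.

Lemma built_connect S t x y : built S t -> x \in S -> y \in S -> connect t x y.
Proof.
move=> b; elim: b x y => {S t} [z|S t u v b IH uS vS euv] x y.
  by rewrite !inE => /eqP-> /eqP->; exact: connect0.
have sub: subrel (connect t) (connect (add_edge t u v)).
  by apply: connect_sub => a c tac; apply: connect1; rewrite /add_edge tac.
have uv : connect (add_edge t u v) u v by apply: connect1; rewrite /add_edge !eqxx orbT.
have vu : connect (add_edge t u v) v u by apply: connect1; rewrite /add_edge !eqxx !orbT.
rewrite !inE => /orP[/eqP->|xS] /orP[/eqP->|yS].
- exact: connect0.
- exact: connect_trans vu (sub _ _ (IH _ _ uS yS)).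
- exact: connect_trans (sub _ _ (IH _ _ xS uS)) uv.
- exact: sub (IH _ _ xS yS).
Qed.

(** A cycle through the last leaf [v] enters and leaves it via its only neighbour [u], so it has at
    most two vertices. *)
Lemma built_acyclic S t : built S t -> acyclic_graph t.
Proof.
move=> b; elim: b => {S t} [z|S t u v b IH uS vS euv] c.
  by case: c => [|x [|y c]] //=; rewrite /ucycle /=.
have tv y : t v y = false.
  by apply/negP => /(built_supp b)/andP[h _]; rewrite h in vS.
have addv y : add_edge t u v v y -> y = u.
  rewrite /add_edge tv /= eqxx /= => /orP[/andP[/eqP vu _]|/eqP //].
  by move: vS; rewrite vu uS.
have addv' y : add_edge t u v y v -> y = u.
  by move=> h; apply: addv; rewrite (built_sym (BuiltS b uS vS euv)).
case/andP=> cyc unq; case vc: (v \in c); last first.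
  apply: IH; rewrite /ucycle unq andbT.
  have cc : all (mem c) c by apply/allP.
  rewrite (eq_in_cycle (e' := add_edge t u v) _ cc) // => x y xc yc; rewrite /add_edge.
  have /negbTE -> : x != v by apply: contraFneq vc => <-.
  have /negbTE -> : y != v by apply: contraFneq vc => <-.
  by rewrite andbF !orbF.
case: (rot_to vc) => i p defp.
have cyc' : cycle (add_edge t u v) (v :: p) by rewrite -defp rot_cycle.
have unq' : uniq (v :: p) by rewrite -defp rot_uniq.
have -> : size c = size (v :: p) by rewrite -defp size_rot.
case: p cyc' unq' {defp} => [|y p] //=; case: (lastP p) => [|q z] //=.
rewrite rcons_path last_rcons => /and3P[/addv -> _ /addv' ->].
by rewrite mem_rcons inE eqxx /= !andbF.
Qed.

Lemma nbhd_add_edge S t u v x : built S t -> u \in S -> v \notin S ->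
  nbhd (add_edge t u v) x =
  if x == v then [set u] else if x == u then v |: nbhd t u else nbhd t x.
Proof.
move=> b uS vS; apply/setP => y.
have tv z : t v z = false.
  by apply/negP => /(built_supp b)/andP[h _]; rewrite h in vS.
have uv : u == v = false by apply: contraNF vS => /eqP <-.
rewrite !inE /add_edge; case: (eqVneq x v) => [->|xv].
  by rewrite !inE tv /= eq_sym uv.
by case: (eqVneq x u) => [->|xu]; rewrite !inE /= ?uv orbF // orbC.
Qed.

Lemma degree_add_edge S t u v x : built S t -> u \in S -> v \notin S ->
  degree (add_edge t u v) x = if x == v then 1 else degree t x + (x == u).
Proof.
move=> b uS vS; rewrite /degree (nbhd_add_edge x b uS vS).
case: (eqVneq x v) => [_|xv]; first by rewrite cards1.
case: (eqVneq x u) => [->|_]; last by rewrite addn0.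
rewrite cardsU1 inE addnC; case tuv: (t u v) => //.
by have /andP[_ h] := built_supp b tuv; rewrite h in vS.
Qed.

Lemma built_attach (f : T -> T) S t (A : {set T}) : built S t -> [disjoint S & A] ->
  (forall y, y \in A -> (f y \in S) && e (f y) y) ->
  exists t', [/\ built (S :|: A) t',
    forall x, x \in S -> degree t' x = degree t x + #|[set y in A | f y == x]| &
    forall x, x \in A -> degree t' x = 1].
Proof.
move=> b; have [k] := ubnP #|A|; elim: k A => // k IH A cA dSA Af.
case: (set_0Vmem A) => [A0|[v vA]].
  exists t; rewrite A0; split=> [|x _|x]; rewrite ?setU0 ?inE //.
  by rewrite (_ : [set _ in _ | _] = set0) ?cards0 ?addn0 //; apply/setP => y; rewrite !inE.
have cA' : #|A :\ v| < k by move: cA; rewrite (cardsD1 v) vA.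
have sAA : A :\ v \subset A by apply: subsetDl.
have [|y|t1 [b1 d1 d1']] := IH _ cA'.
- exact: disjointWr sAA dSA.
- by move/(subsetP sAA)/Af.
have /andP[fvS efv] := Af _ vA.
have vS : v \notin S by rewrite (disjointFl dSA vA).
have fvS1 : f v \in S :|: A :\ v by rewrite inE fvS.
have vS1 : v \notin S :|: A :\ v by rewrite !inE eqxx (negbTE vS).
exists (add_edge t1 (f v) v); split.
- have -> : S :|: A = v |: (S :|: A :\ v) by rewrite setUCA setD1K.
  exact: BuiltS.
- move=> x xS; rewrite (degree_add_edge x b1 fvS1 vS1) d1 //.
  have /negbTE -> : x != v by apply: contraNneq vS => <-.
  rewrite -addnA; congr (_ + _).
  rewrite [RHS](cardsD1 v) inE vA /= eq_sym addnC; congr (_ + _).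
  by apply: eq_card => y; rewrite !inE andbA.
- move=> x xA; rewrite (degree_add_edge x b1 fvS1 vS1).
  case: (eqVneq x v) => [//|xv]; rewrite d1' ?inE ?xv //.
  have /negbTE -> // : x != f v.
  by apply: contraTneq xA => ->; rewrite (disjointFr dSA fvS).
Qed.

(* [grows C I0 I k]: I is obtained from I0 in k steps, each adding a vertex of C
   adjacent to the current set (possibly one already in it). *)
Inductive grows (C I0 : {set T}) : {set T} -> nat -> Prop :=
| Grow0 : grows C I0 I0 0
| GrowS I k u v : grows C I0 I k -> u \in I -> v \in C -> e u v ->
    grows C I0 (v |: I) k.+1.

Lemma grows_sub C I0 I k : grows C I0 I k -> I0 \subset I /\ I \subset I0 :|: C.
Proof.
elim=> {I k} [|I k u v _ [IH1 IH2] uI vC _]; first by rewrite subxx subsetUl.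
split; first exact: subset_trans IH1 (subsetUr _ _).
by rewrite subUset sub1set inE vC orbT.
Qed.

Lemma grows_card C I0 I k (D : {set T}) : grows C I0 I k -> #|I :\: D| <= #|I0 :\: D| + k.
Proof.
elim=> {I k} [|I k u v _ IH _ _ _]; first by rewrite addn0.
rewrite setDUl; apply: leq_trans (leq_card_setU _ _) _.
have : #|[set v] :\: D| <= 1 by rewrite -(cards1 v) subset_leq_card ?subsetDl.
lia.
Qed.

Lemma grows_trans C I0 I1 I2 k1 k2 : grows C I0 I1 k1 -> grows C I1 I2 k2 ->
  grows C I0 I2 (k2 + k1).
Proof.
move=> g1; elim=> {I2 k2} [//|I k u v _ IH uI vC euv].
by rewrite addSn; apply: GrowS IH uI vC euv.
Qed.

(** A step to a vertex already in the tree adds no edge, and every new edge starts in [I]; so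
    vertices of [V0] outside the final [I] keep their degree. *)
Lemma built_grow V0 t0 C (I0 I : {set T}) k : built V0 t0 -> I0 \subset V0 ->
  (forall x, x \in V0 -> 0 < degree t0 x) -> grows C I0 I k ->
  exists t, [/\ built (V0 :|: I) t,
    forall x, x \in V0 -> degree t0 x <= degree t x,
    forall x, x \in V0 :\: I -> degree t x = degree t0 x &
    forall x, x \in V0 :|: I -> 0 < degree t x].
Proof.
move=> b0 sI0 pos0; elim=> {I k} [|I k u v g [t [b d1 d2 d3]] uI vC euv].
  by exists t0; rewrite (setUidPl sI0).
case vS: (v \in V0 :|: I).
  exists t; have -> : V0 :|: (v |: I) = V0 :|: I.
    by rewrite setUCA; apply/setUidPr; rewrite sub1set.
  split=> // x; rewrite !inE negb_or => /andP[/andP[_ xI] xV].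
  by rewrite d2 // inE xI.
have uS : u \in V0 :|: I by rewrite inE uI orbT.
have {vS} vS := negbT vS.
exists (add_edge t u v); rewrite setUCA; split.
- exact: BuiltS.
- move=> x xV; rewrite (degree_add_edge x b uS vS).
  case: eqP => [xv|_]; first by move: vS; rewrite -xv inE xV.
  by apply: leq_trans (d1 _ xV) (leq_addr _ _).
- move=> x; rewrite !inE negb_or => /andP[/andP[xv xI] xV].
  rewrite (degree_add_edge x b uS vS) (negbTE xv).
  have /negbTE -> : x != u by apply: contraNneq xI => ->.
  by rewrite addn0 d2 // inE xI.
- move=> x; rewrite (degree_add_edge x b uS vS) in_setU1.
  by case: eqP => //= _ /d3 h; rewrite ltn_addr.
Qed.

(** Greedy choice: [Ex] and the earlier picks block at most [#|Ex| + 2 * (#|J| - 1)] neighbours of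
    the next vertex, so two remain free. *)
Lemma private_leaves (J Ex : {set T}) :
  (forall j, j \in J -> #|Ex| + 2 * #|J| <= degree e j) ->
  exists (A : {set T}) (f : T -> T),
    [/\ [disjoint Ex & A], forall y, y \in A -> (f y \in J) && e (f y) y &
        forall j, j \in J -> 2 <= #|[set y in A | f y == j]|].
Proof.
move=> degJ.
suff priv (K : {set T}) : K \subset J -> exists (A : {set T}) (f : T -> T),
    [/\ [disjoint Ex & A], #|A| = 2 * #|K|, forall y, y \in A -> (f y \in K) && e (f y) y &
        forall j, j \in K -> 2 <= #|[set y in A | f y == j]|].
  by have [A [f [dA _ Af Jf]]] := priv J (subxx J); exists A, f.
have [k] := ubnP #|K|; elim: k K => // k IH K cK sKJ.
case: (set_0Vmem K) => [->|[v vK]].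
  exists set0, id; rewrite !cards0 disjoint_sym disjoints_subset sub0set.
  by split=> // y; rewrite inE.
have cKv : #|K| = #|K :\ v|.+1 by rewrite (cardsD1 v) vK.
have [|A [f [dA cA Af Kf]]] := IH (K :\ v) _ (subset_trans (subsetDl _ _) sKJ).
  by rewrite -ltnS -cKv.
have vJ := subsetP sKJ _ vK.
have : 2 <= #|nbhd e v :\: (Ex :|: A)|.
  have := degJ _ vJ; have := subset_leq_card sKJ.
  have := cardsID (Ex :|: A) (nbhd e v).
  have : #|nbhd e v :&: (Ex :|: A)| <= #|Ex| + #|A|.
    apply: leq_trans (leq_card_setU _ _); apply: subset_leq_card; exact: subsetIr.
  rewrite /degree; lia.
case/card_gt1P=> y1 [y2 []]; rewrite !inE !negb_or.
move=> /andP[/andP[y1E y1A] ev1] /andP[/andP[y2E y2A] ev2] y12.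
exists (y1 |: (y2 |: A)), (fun y => if y \in A then f y else v); split.
- rewrite disjoint_sym disjoints_subset !subUset !sub1set !inE y1E y2E /=.
  by rewrite -disjoints_subset disjoint_sym.
- by rewrite !cardsU1 !inE negb_or y12 y1A y2A cA cKv mulnS.
- move=> y; case yA: (y \in A).
    by move=> _; have /andP[] := Af _ yA; rewrite inE => /andP[_ ->] ->.
  by rewrite !inE yA orbF vK => /orP[] /eqP ->.
- move=> j jK; case: (eqVneq j v) => [->|jv].
    apply/card_gt1P; exists y1, y2; rewrite !inE (negbTE y1A) (negbTE y2A) !eqxx.
    by rewrite y12 orbT.
  have /Kf jA : j \in K :\ v by rewrite !inE jv jK.
  apply: leq_trans jA _.
  apply: subset_leq_card; apply/subsetP => y; rewrite !inE => /andP[yA fy].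
  by rewrite yA !orbT.
Qed.

(* The vertices of Int0 get their degree from the initial tree t0, those of
   I :\: Int0 from private leaves. *)
Lemma HIST_of_growth V0 t0 C (Int0 I0 I : {set T}) k :
  built V0 t0 -> I0 \subset V0 ->
  (forall x, x \in V0 -> 0 < degree t0 x) ->
  (forall x, x \in V0 :\: I0 -> degree t0 x = 1) ->
  Int0 \subset I0 ->
  (forall x, x \in Int0 -> 3 <= degree t0 x) ->
  grows C I0 I k ->
  (forall x, x \notin V0 :|: I -> exists2 y, y \in I & e y x) ->
  (forall x, x \in I :\: Int0 -> #|V0 :|: I| + 2 * #|I :\: Int0| <= degree e x) ->
  has_HIST e.
Proof.
move=> b0 sI0 pos0 leaf0 sInt deg3 g dom degI.
have [t1 [b1 mono1 eq1 pos1]] := built_grow b0 sI0 pos0 g.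
have [A [f [dA Af Jf]]] := private_leaves degI.
(* Private leaves go to their owners, other outside vertices to any neighbour in [I]. For these
   [dom] rules out the default [y]. *)
pose f' y := if y \in A then f y else odflt y [pick z in I | e z y].
have f'P y : y \in ~: (V0 :|: I) -> (f' y \in I) && e (f' y) y.
  rewrite inE => yVI; rewrite /f'; case yA: (y \in A).
    by have /andP[] := Af _ yA; rewrite inE => /andP[_ ->] ->.
  case: pickP => [//|none]; have [z zI ezy] := dom _ yVI.
  by have := none z; rewrite zI ezy.
have dS : [disjoint V0 :|: I & ~: (V0 :|: I)] by rewrite disjoints_subset setCK.
have [|t [bt d1 d2]] := built_attach (f := f') b1 dS.
  by move=> y /f'P/andP[h ->]; rewrite inE h orbT.
rewrite setUCr in bt.
exists t; split.
  split; last exact: built_sub bt.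
  split; [exact: built_simple bt| |exact: built_acyclic bt].
  by move=> x y; apply: built_connect bt _ _; rewrite inE.
have [sI00 _] := grows_sub g.
move=> x; case xS: (x \in V0 :|: I); last by rewrite d2 // inE xS.
rewrite d1 //; case xI: (x \in I).
  apply/eqP; rewrite neq_ltn; apply/orP; right.
  case xInt: (x \in Int0).
    have xV := subsetP sI0 _ (subsetP sInt _ xInt).
    exact: leq_trans (leq_trans (deg3 _ xInt) (mono1 _ xV)) (leq_addr _ _).
  have xJ : x \in I :\: Int0 by rewrite inE xInt.
  apply: (@leq_add 1 2); first exact: pos1.
  apply: leq_trans (Jf _ xJ) _.
  apply: subset_leq_card; apply/subsetP => y; rewrite !inE => /andP[yA fy].
  by rewrite /f' yA fy andbT; have := disjointFl dA yA; rewrite !inE => ->.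
(* Vertices of [V0] outside [I] are leaves of [t0] and stay leaves, since [f'] maps into [I]. *)
have xV : x \in V0 by move: xS; rewrite inE xI orbF.
have xnI0 : x \in V0 :\: I0.
  by rewrite inE xV andbT; apply/negP => /(subsetP sI00); rewrite xI.
rewrite eq1 ?inE ?xI // leaf0 //.
rewrite (_ : [set _ in _ | _] = set0) ?cards0 //.
apply/setP => y; rewrite in_set0; apply/negP; rewrite inE => /andP[/f'P/andP[h _] /eqP fy].
by move: h; rewrite fy xI.
Qed.

Lemma built_star a (Q : {set T}) : Q \subset nbhd e a ->
  exists t, [/\ built (a |: Q) t, degree t a = #|Q| & forall x, x \in Q -> degree t x = 1].
Proof.
move=> QN.
have aQ : [disjoint [set a] & Q].
  rewrite disjoints1; apply/negP => /(subsetP QN); by rewrite inE e_irr.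
have [|t [b d1 d2]] := built_attach (f := fun _ => a) (Built1 a) aQ.
  by move=> y /(subsetP QN); rewrite !inE eqxx.
exists t; split=> //; rewrite d1 ?inE //.
rewrite (_ : degree _ a = 0); last by apply: eq_card0 => y; rewrite inE.
by apply: eq_card => y; rewrite inE eqxx andbT.
Qed.

End Trees.

(** * The number of growth steps *)

(* The breakpoints up to 136 come from the worst-case recursion for the steps in the
   proof of [dominate] at n = 270 with w vertices undominated; from 136 on, one
   vertex per 22 is an upper bound for the value of that recursion. *)
Definition growth_cost (w : nat) : nat :=
  count (fun b => b <= w) [:: 1; 2; 3; 4; 6; 8; 11; 15; 20; 27; 35; 45; 58; 73; 91; 112; 136]
  + (w - 136) %/ 22.

Lemma growth_cost_mono w1 w2 : w1 <= w2 -> growth_cost w1 <= growth_cost w2.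
Proof.
move=> le12; apply: leq_add; last by apply: leq_div2r; lia.
by apply: sub_count => b /leq_trans; apply.
Qed.

Lemma growth_cost_large w : 136 <= w -> growth_cost w = 17 + (w - 136) %/ 22.
Proof.
move=> h; rewrite /growth_cost /=.
by do !(rewrite (leq_trans _ h) //).
Qed.

(* The quotient is the least integral d + 1 allowed by the hypothesis [avg] of
   [growth_cost_step] for n = 270. *)
Definition step_check (w g : nat) : bool :=
  (growth_cost (w - g) < growth_cost w) ||
  [&& 4 * g <= w &
  growth_cost (w - N.to_nat ((270 * N.of_nat w - 4 * N.of_nat g * (270 - N.of_nat w)
     + 4 * N.of_nat w - 1) / (4 * N.of_nat w))%num) + 2 <= growth_cost w].

Lemma step_checkP : all (fun w => all (step_check w) (iota 1 w)) (iota 1 203).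
Proof. by vm_compute. Qed.

Lemma star_check : all (fun w => growth_cost (w - 68) + 3 <= growth_cost w) (iota 68 136).
Proof. by vm_compute. Qed.

(* w: undominated vertices; g: most neighbours of a dominated vertex among them;
   d: most neighbours of an undominated vertex among them. The hypothesis [avg] is
   the degree count, for degrees at least n/4 - 1. *)
Lemma growth_cost_step n w g d : 270 <= n -> 0 < g <= w -> w <= n ->
  n * w <= 4 * w * d.+1 + 4 * g * (n - w) ->
  (growth_cost (w - g) < growth_cost w) || (growth_cost (w - d.+1) + 2 <= growth_cost w).
Proof.
move=> n_ge /andP[g0 gw] wn avg; case: (ltnP w 204) => [w_lt|w_ge].
  have := allP step_checkP w; rewrite mem_iota => /(_ ltac:(lia)) /allP /(_ g).
  rewrite mem_iota => /(_ ltac:(lia)) /orP[-> //|/andP[g4 ok]].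
  apply/orP; right; apply: leq_trans ok; rewrite leq_add2r; apply: growth_cost_mono.
  apply: leq_sub2l.
  suff : ((270 * N.of_nat w - 4 * N.of_nat g * (270 - N.of_nat w)
     + 4 * N.of_nat w - 1) / (4 * N.of_nat w) <= N.of_nat d.+1)%num by lia.
  (* Because [4 * g <= w], the inequality [avg] only gets weaker as [n] decreases, so it may be
     taken at [n = 270]. *)
  have avg' : 270 * w <= 4 * w * d.+1 + 4 * g * (270 - w) by nia.
  apply/N.lt_succ_r; apply: N.Div0.div_lt_upper_bound; nia.
(* Here 22 vertices pay for one step: either [g] suffices alone, or [avg] forces [d.+1 >= 44],
   enough for two steps. *)
case: (leqP 22 g) => [g22|g_lt].
  apply/orP; left; rewrite [X in _ < X]growth_cost_large; last lia.
  apply: leq_ltn_trans (growth_cost_mono (_ : _ <= w - 22)) _; first lia.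
  by rewrite growth_cost_large; lia.
apply/orP; right; have d_ge : 44 <= d.+1.
  rewrite leqNgt; apply/negP => d_lt.
  have : n * w <= 172 * w + 84 * (n - w) by nia.
  nia.
apply: leq_trans (_ : growth_cost (w - 44) + 2 <= _).
  by rewrite leq_add2r; apply: growth_cost_mono; lia.
rewrite !growth_cost_large; lia.
Qed.

(* 68 - 1 is the least degree compatible with n <= 4(deg + 1) for n >= 270. *)
Lemma growth_cost_star w m : 68 <= m <= w -> growth_cost (w - m) + 3 <= growth_cost w.
Proof.
move=> /andP[m_ge mw]; apply: leq_trans (_ : growth_cost (w - 68) + 3 <= _).
  by rewrite leq_add2r; apply: growth_cost_mono; lia.
case: (ltnP w 204) => [w_lt|w_ge].
  by have := allP star_check w; rewrite mem_iota; apply; lia.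
rewrite !growth_cost_large; lia.
Qed.

(** [d'] is the degree of a high vertex of the initial set, so [w] is below 3n/4; [d] is the degree
    of a vertex needing private leaves. A step uses three vertices, the new one and its two leaves;
    8 pays for an initial tree of at most six vertices and two private leaves. *)
Lemma growth_cost_budget n d d' w : 270 <= n -> n <= 4 * d -> n <= 4 * d' ->
  w + d' < n -> 3 * growth_cost w + 8 <= d.
Proof.
move=> n_ge nd nd' wn; case: (leqP 136 w) => [w_ge|w_lt].
  rewrite growth_cost_large //; lia.
have : growth_cost w <= growth_cost 136 by apply: growth_cost_mono; lia.
have -> : growth_cost 136 = 17 by [].
lia.
Qed.

(** * Dominating sets *)

Section Domination.
Variables (T : finType) (e : rel T).
Hypotheses (e_sym : symmetric e) (e_irr : irreflexive e).

Definition undominated (C I : {set T}) : {set T} :=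
  [set x in C | (x \notin I) && [forall y in I, ~~ e y x]].

Lemma undominatedP (C I : {set T}) x :
  reflect [/\ x \in C, x \notin I & forall y, y \in I -> ~~ e y x] (x \in undominated C I).
Proof.
rewrite inE; apply: (iffP and3P) => [[xC xI /'forall_implyP h]|[xC xI h]]; split=> //.
exact/'forall_implyP.
Qed.

Lemma in_nbhd x y : (y \in nbhd e x) = e x y.
Proof. by rewrite inE. Qed.

Lemma sum_nbhd_exchange (A B : {set T}) :
  \sum_(x in A) #|nbhd e x :&: B| = \sum_(z in B) #|nbhd e z :&: A|.
Proof.
have E x (D : {set T}) : #|nbhd e x :&: D| = \sum_(z in D) e x z.
  by rewrite setIC -sum1dep_card big_mkcondr /=; apply: eq_bigr => z _; rewrite inE; case: (e x z).
under eq_bigr do rewrite E; rewrite exchange_big /=; apply: eq_bigr => z _.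
by rewrite E; apply: eq_bigr => x _; rewrite e_sym.
Qed.

(* Three kinds of steps: add the dominated vertex z with the most undominated
   neighbours; add the undominated vertex v with the most undominated neighbours,
   together with a dominated neighbour of v; or, if v has none, add an undominated
   x all of whose neighbours in C are undominated, at distance 2 from the dominated
   ones, together with a path to it. *)
Lemma dominate (C I0 : {set T}) : 270 <= #|T| ->
  (forall x, x \in undominated C I0 -> #|T| <= 4 * #|nbhd e x :&: C|.+1) ->
  (forall X : {set T}, X \subset undominated C I0 -> X != set0 ->
    exists x z, [/\ x \in X, z \in C :\: X & e x z]) ->
  exists I k, [/\ grows e C I0 I k, undominated C I = set0 &
    k <= growth_cost #|undominated C I0|].
Proof.
move=> n_ge; have [w] := ubnP #|undominated C I0|; elim: w I0 => // w IH I0 wI0.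
set W := undominated C I0 => degW exitW.
have [W0|[v0 v0W]] := set_0Vmem W.
  by exists I0, 0; split=> //; apply: Grow0.
(* If dominating [m] more vertices lowers the cost by at least [c], the induction continues from
   [I1]. *)
have step I1 c m : grows e C I0 I1 c -> 0 < m <= #|W| ->
    #|undominated C I1| <= #|W| - m -> growth_cost (#|W| - m) + c <= growth_cost #|W| ->
    exists I k, [/\ grows e C I0 I k, undominated C I = set0 & k <= growth_cost #|W|].
  move=> g1 /andP[m0 mW] cI1 cost; have [sI _] := grows_sub g1.
  have sW : undominated C I1 \subset W.
    apply/subsetP => x /undominatedP[xC xI h]; apply/undominatedP; split=> //.
      by apply: contraNN xI => /(subsetP sI).
    by move=> y /(subsetP sI)/h.
  case: (IH I1) => [||X XI1|I [k [g2 dom k_le]]].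
  - by move: wI0; rewrite -/W; lia.
  - by move=> x /(subsetP sW)/degW.
  - by apply: exitW; apply: subset_trans sW.
  - exists I, (k + c); split=> //; first exact: grows_trans g2.
    have := growth_cost_mono cI1; lia.
have drop (I1 D : {set T}) : I0 \subset I1 -> D \subset W ->
    (forall x, x \in D -> (x \in I1) || [exists y in I1, e y x]) ->
    #|undominated C I1| <= #|W| - #|D|.
  move=> sI DW Ddom.
  have -> : #|W| - #|D| = #|W :\: D| by rewrite cardsD (setIidPr DW).
  apply: subset_leq_card; apply/subsetP => x /undominatedP[xC xI h]; rewrite inE.
  apply/andP; split; last first.
    apply/undominatedP; split=> //; first by apply: contraNN xI => /(subsetP sI).
    by move=> y /(subsetP sI)/h.
  apply/negP => /Ddom; rewrite (negbTE xI) => /exists_inP[y yI].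
  by rewrite (negbTE (h _ yI)).
(* A dominated vertex with an undominated neighbour is not itself in [I0], hence it is adjacent to
   [I0]. *)
have toI0 z x : z \in C :\: W -> x \in W -> e z x -> exists2 u, u \in I0 & e u z.
  rewrite inE => /andP[zW zC] /undominatedP[xC xI h] ezx.
  move: zW; rewrite inE zC /= negb_and negbK => /orP[zI|].
    by have := h _ zI; rewrite ezx.
  by rewrite negb_forall_in => /exists_inP[u uI]; rewrite negbK => euz; exists u.
have [||x0 [z0 [x0W z0B ez0]]] := exitW W; rewrite ?subxx //; first by apply/set0Pn; exists v0.
have [z zB zmax] := @arg_maxnP _ z0 (mem (C :\: W)) (fun z => #|nbhd e z :&: W|) z0B.
have [v vW vmax] := @arg_maxnP _ v0 (mem W) (fun v => #|nbhd e v :&: W|) v0W.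
have {}zB : z \in C :\: W := zB; have {}vW : v \in W := vW.
set g := #|nbhd e z :&: W| in zmax; set d := #|nbhd e v :&: W| in vmax.
have g_gt0 : 0 < g.
  apply: leq_trans (zmax _ z0B); apply/card_gt0P; exists x0.
  by rewrite in_setI in_nbhd e_sym ez0.
have d_lt : d < #|W|.
  rewrite (cardsD1 v W) vW ltnS; apply: subset_leq_card.
  apply/subsetP => y; rewrite !in_setI in_nbhd in_setD1 => /andP[evy ->]; rewrite andbT.
  by apply: contraTneq evy => ->; rewrite e_irr.
(* Count the edges from [W] into [C]: those inside [W] by [d], those to [C :\: W] by [g] from the
   other end. *)
have avg : #|T| * #|W| <= 4 * #|W| * d.+1 + 4 * g * (#|T| - #|W|).
  have h1 : \sum_(x in W) #|nbhd e x :&: C| =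
      \sum_(x in W) #|nbhd e x :&: W| + \sum_(x in W) #|nbhd e x :&: (C :\: W)|.
    rewrite -big_split /=; apply: eq_bigr => x _.
    rewrite -(cardsID W (nbhd e x :&: C)) -setIA -setIDA; congr (#|_ :&: _| + _).
    by apply/setIidPr; apply/subsetP => y /undominatedP[].
  have h2 : \sum_(x in W) #|nbhd e x :&: W| <= #|W| * d.
    by rewrite -sum_nat_const; apply: leq_sum => x; apply: vmax.
  have h3 : \sum_(x in W) #|nbhd e x :&: (C :\: W)| <= (#|T| - #|W|) * g.
    rewrite sum_nbhd_exchange; apply: leq_trans (_ : #|C :\: W| * g <= _).
      by rewrite -sum_nat_const; apply: leq_sum => x; apply: zmax.
    rewrite leq_mul2r -cardsT -cardsDS ?subsetT // subset_leq_card ?orbT //.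
    exact: setSD (subsetT _).
  have h4 : #|W| * #|T| <= 4 * (\sum_(x in W) #|nbhd e x :&: C| + #|W|).
    rewrite -sum_nat_const -[X in _ + X]sum1_card -big_split big_distrr /=.
    by apply: leq_sum => x xW; rewrite addn1 degW.
  nia.
have gW : g <= #|W| by rewrite subset_leq_card ?subsetIr.
case/orP: (growth_cost_step n_ge (introT andP (conj g_gt0 gW)) (max_card _) avg) => cost.
  have [x] := card_gt0P g_gt0; rewrite in_setI in_nbhd => /andP[ezx xW].
  have [u uI euz] := toI0 _ _ zB xW ezx.
  have zC : z \in C by move: zB; rewrite inE => /andP[].
  apply: (step _ _ g (GrowS (Grow0 e C I0) uI zC euz)); rewrite ?g_gt0 ?addn1 //.
  apply: drop; [exact: subsetUr|exact: subsetIr|] => y; rewrite in_setI in_nbhd => /andP[ezy _].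
  by apply/orP; right; apply/exists_inP; exists z; rewrite ?inE ?eqxx.
pose X := [set x in W | [forall y in C :\: W, ~~ e x y]].
case vX: (v \in X); last first.
  move: vX; rewrite inE vW /= => /negbT; rewrite negb_forall_in => /exists_inP[y yB].
  rewrite negbK => evy; have [|u uI euy] := toI0 _ _ yB vW; first by rewrite e_sym.
  have yC : y \in C by move: yB; rewrite inE => /andP[].
  have vC : v \in C by case/undominatedP: vW.
  have g1 := GrowS (Grow0 e C I0) uI yC euy.
  have eyv : e y v by rewrite e_sym.
  have g2 := GrowS g1 (setU11 _ _) vC eyv.
  apply: (step _ _ d.+1 g2) => //.
  have -> : d.+1 = #|v |: (nbhd e v :&: W)|.
    by rewrite cardsU1 in_setI in_nbhd e_irr.
  apply: drop; first by rewrite setUCA; apply: subset_trans (subsetUr _ _) (subsetUr _ _).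
    by rewrite subUset sub1set vW subsetIr.
  move=> x; rewrite in_setU1 in_setI in_nbhd => /orP[/eqP->|/andP[evx _]];
    rewrite ?setU11 //; apply/orP; right.
  by apply/exists_inP; exists v; rewrite ?inE ?eqxx.
have [||x [y [xX yCX exy]]] := exitW X.
- by apply/subsetP => x; rewrite inE => /andP[].
- by apply/set0Pn; exists v.
move: xX; rewrite inE => /andP[xW /'forall_implyP xB].
move: yCX; rewrite inE => /andP[yX yC].
have yW : y \in W.
  by apply: contraTT exy => yW; apply: xB; rewrite inE yW.
move: yX; rewrite inE yW /= negb_forall_in => /exists_inP[q qB]; rewrite negbK => eyq.
have [|u uI euq] := toI0 _ _ qB yW; first by rewrite e_sym.
have qC : q \in C by move: qB; rewrite inE => /andP[].
have xC : x \in C by case/undominatedP: xW.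
have eqy : e q y by rewrite e_sym.
have eyx : e y x by rewrite e_sym.
have g3 := GrowS (GrowS (GrowS (Grow0 e C I0) uI qC euq) (setU11 _ _) yC eqy) (setU11 _ _) xC eyx.
(* All neighbours of [x] in [C] are undominated, so adding [x] dominates at least n/4 new vertices,
   which pays for three steps. *)
have NxW : nbhd e x :&: C = nbhd e x :&: W.
  apply/setP => t; rewrite !in_setI; case ext: (t \in nbhd e x) => //=.
  apply/idP/idP => [tC|/undominatedP[] //].
  by apply: contraTT ext => tW; rewrite inE xB // inE tW.
have xN : x \notin nbhd e x :&: W by rewrite in_setI in_nbhd e_irr.
have sD : x |: (nbhd e x :&: W) \subset W by rewrite subUset sub1set xW subsetIr.
have cD : #|x |: (nbhd e x :&: W)| = #|nbhd e x :&: W|.+1 by rewrite cardsU1 xN.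
have dx := degW _ xW; rewrite NxW -cD in dx.
have cDW := subset_leq_card sD.
apply: (step _ _ #|x |: (nbhd e x :&: W)| g3).
- by rewrite cDW andbT cD.
- apply: drop => //; first by rewrite !(subset_trans _ (subsetUr _ _)).
  move=> t; rewrite in_setU1 in_setI in_nbhd => /orP[/eqP->|/andP[ext _]];
    rewrite ?setU11 //; apply/orP; right.
  by apply/exists_inP; exists x; rewrite ?inE ?eqxx.
- by apply: growth_cost_star; rewrite cDW andbT; move: n_ge dx; clear; lia.
Qed.
End Domination.

(** * Low and high vertices *)

Section Structure.
Variables (T : finType) (e : rel T).
Hypotheses (e_sym : symmetric e) (e_irr : irreflexive e) (e_conn : connected_graph e).
Hypothesis n_ge : 270 <= #|T|.
Hypothesis NC : forall u v, u != v -> ~~ e u v -> #|T| <= 2 * #|nbhd e u :|: nbhd e v|.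

Let Low : {set T} := [set v | 4 * degree e v < #|T|].
Let High : {set T} := ~: Low.
Let N := nbhd e.

Lemma NE x y : (y \in N x) = e x y.
Proof. exact: in_nbhd. Qed.

Lemma lowE v : (v \in Low) = (4 * degree e v < #|T|).
Proof. by rewrite inE. Qed.

Lemma highE v : (v \in High) = (#|T| <= 4 * degree e v).
Proof. by rewrite inE lowE -leqNgt. Qed.

Lemma highC v : (v \in High) = (v \notin Low).
Proof. by rewrite inE. Qed.

Lemma card_low_high : #|Low| + #|High| = #|T|.
Proof. exact: cardsC. Qed.

(** Two nonadjacent low vertices would have fewer than n/2 neighbours together. *)
Lemma low_clique u v : u \in Low -> v \in Low -> u != v -> e u v.
Proof.
rewrite !lowE /degree => du dv uv; apply: contraT => /(NC uv).
have := (leq_card_setU (nbhd e u) (nbhd e v)).1; lia.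
Qed.

Lemma low_degree a : a \in Low -> (degree e a).+1 = #|Low| + #|N a :&: High|.
Proof.
move=> aL; rewrite /degree -(cardsID Low (nbhd e a)) setDE -addSn; congr (_ + _).
rewrite (cardsD1 a Low) aL add1n; congr _.+1; apply: eq_card => y.
rewrite in_setI in_setD1 NE; case: (eqVneq y a) => [->|ya]; first by rewrite e_irr.
by case yL: (y \in Low); rewrite ?andbF // low_clique // eq_sym.
Qed.

Lemma exit_edge (X : {set T}) x0 y0 : x0 \in X -> y0 \notin X ->
  exists x y, [/\ x \in X, y \notin X & e x y].
Proof.
move=> x0X y0X; suff: [exists x in X, exists y in ~: X, e x y].
  case/exists_inP=> x xX /exists_inP[y yX exy]; exists x, y.
  by move: yX; rewrite inE.
apply: contraT; rewrite negb_exists_in => /forall_inP h.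
have cl x y : e x y -> x \in X -> y \in X.
  move=> exy xX; apply: contraT => yX; have := h x xX.
  by rewrite negb_exists_in => /forall_inP/(_ y); rewrite inE yX exy => /(_ isT).
have clX : closed e (mem X).
  by move=> x y exy; apply/idP/idP; apply: cl; rewrite // e_sym.
have E : (x0 \in X) = (y0 \in X) := closed_connect clX (e_conn x0 y0).
by rewrite E (negbTE y0X) in x0X.
Qed.

(* X is a union of components of the graph induced by the high vertices. *)
Definition separated (X : {set T}) : bool :=
  (X \subset High) && [forall x in X, forall z in High :\: X, ~~ e x z].

Lemma separatedP (X : {set T}) :
  reflect (X \subset High /\ forall x z, x \in X -> z \in High -> e x z -> z \in X)
    (separated X).
Proof.
apply: (iffP andP) => -[XH h]; split=> //.
  move=> x z xX zH exz; apply: contraT => zX.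
  by have := forall_inP (forall_inP h x xX) z; rewrite inE zX zH exz => /(_ isT).
apply/forall_inP => x xX; apply/forall_inP => z; rewrite inE => /andP[zX zH].
by apply: contra zX; apply: h.
Qed.

Lemma exit_or_separated (X : {set T}) : X \subset High ->
  (exists x z, [/\ x \in X, z \in High :\: X & e x z]) \/ separated X.
Proof.
move=> XH; case sX: (separated X); [by right|left].
move: sX; rewrite /separated XH /= => /negbT; rewrite negb_forall_in => /exists_inP[x xX].
rewrite negb_forall_in => /exists_inP[z zX]; rewrite negbK => exz; by exists x, z.
Qed.

Lemma separatedD (X Y : {set T}) : separated X -> separated Y -> separated (X :\: Y).
Proof.
move=> /separatedP[XH hX] /separatedP[YH hY]; apply/separatedP; split.
  exact: subset_trans (subsetDl _ _) XH.
move=> x z; rewrite !in_setD => /andP[xY xX] zH exz; rewrite (hX x) // andbT.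
by apply: contra xY => zY; apply: (hY z); rewrite ?(subsetP XH) // e_sym.
Qed.

Lemma separated_high : separated High.
Proof. exact/separatedP. Qed.

(** If [a] saw all of [X], its closed neighbourhood would contain [X] and [Low], hence every
    neighbour of any [x] in [X], and [x] would be low. *)
Lemma separated_nonnbr (X : {set T}) a : separated X -> X != set0 -> a \in Low ->
  exists2 x, x \in X & ~~ e x a.
Proof.
move=> /separatedP[XH hX] /set0Pn[x xX] aL; apply/exists_inP; apply: contraT.
rewrite negb_exists_in => /forall_inP h.
have XN : X \subset N a :&: High.
  by apply/subsetP => y yX; rewrite in_setI NE (subsetP XH) // e_sym -[e _ _]negbK h.
have Nx : N x \subset X :\ x :|: Low.
  apply/subsetP => y; rewrite NE => exy; rewrite in_setU in_setD1.
  case yL: (y \in Low); rewrite ?orbT // (hX x) ?highC ?yL // andbT orbF.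
  by apply: contraTneq exy => ->; rewrite e_irr.
have := subset_leq_card XN; have := low_degree aL.
have := leq_trans (subset_leq_card Nx) (leq_card_setU _ _).
have := subsetP XH _ xX; rewrite highE; move: aL; rewrite lowE.
rewrite (cardsD1 x X) xX /degree -/(N x); clear; lia.
Qed.

(* Compare a with a vertex of X not adjacent to it. *)
Lemma separated_count (X : {set T}) a : separated X -> X != set0 -> a \in Low ->
  #|T| + 4 <= 2 * (#|X| + #|Low| + #|N a :&: (High :\: X)|).
Proof.
move=> sX X0 aL; have [x xX xa] := separated_nonnbr sX X0 aL.
have /separatedP[XH hX] := sX.
have x_a : x != a.
  by apply: contraTneq aL => <-; rewrite -highC (subsetP XH).
(* Neither [x] nor [a] is in the union; leaving both out gives the summand 4. *)
have sub : N x :|: N a \subset X :\ x :|: Low :\ a :|: N a :&: (High :\: X).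
  apply/subsetP => y; rewrite !in_setU !in_setI !in_setD !NE !in_set1.
  case: (eqVneq y a) => [->|ya]; first by rewrite (negbTE xa) e_irr.
  rewrite highC; case yL: (y \in Low); rewrite ?orbT //= !andbT !orbF.
  case: (eqVneq y x) => [->|yx]; first by rewrite e_irr e_sym (negbTE xa).
  case yX: (y \in X) => //= /orP[exy|->//].
  by have := hX x y xX; rewrite highC yL yX => /(_ isT exy).
have := NC x_a xa; have := subset_leq_card sub; rewrite -/(N x) -/(N a).
have := (leq_card_setU (X :\ x :|: Low :\ a) (N a :&: (High :\: X))).1.
have := (leq_card_setU (X :\ x) (Low :\ a)).1.
rewrite (cardsD1 x X) (cardsD1 a Low) xX aL; lia.
Qed.

(** Low neighbours of [x] are neighbours of [a]. So of the n/2 vertices in the union, [a] covers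
    fewer than n/4 and high neighbours of [x] the rest. *)
Lemma high_degree a x : a \in Low -> x \in High -> ~~ e x a ->
  #|T| <= 4 * #|N x :&: High|.
Proof.
move=> aL xH xa; have x_a : x != a by apply: contraTneq aL => <-; rewrite -highC.
have sub : N x :|: N a \subset N x :&: High :|: N a.
  apply/subsetP => y; rewrite !in_setU in_setI !NE highC => /orP[exy|->]; last by rewrite orbT.
  case yL: (y \in Low); rewrite exy //= low_clique //.
  by apply: contraTneq exy => <-.
have := NC x_a xa; have := leq_trans (subset_leq_card sub) (leq_card_setU _ _).
move: aL; rewrite lowE /degree -/(N a) -/(N x); lia.
Qed.

(** Add [separated_count] for [X] and for [High :\: X]; the terms in [#|T|] cancel. *)
Lemma separated_degree (X : {set T}) a : separated X -> X != set0 -> High :\: X != set0 ->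
  a \in Low -> 3 <= degree e a.
Proof.
move=> sX X0 Y0 aL; have XH : X \subset High by case/andP: sX.
have := separated_count sX X0 aL.
have := separated_count (separatedD separated_high sX) Y0 aL.
rewrite setDDr setDv set0U (setIidPr XH).
have := low_degree aL; have := card_low_high.
have := cardsID X High; rewrite (setIidPr XH).
have := cardsID X (N a :&: High); rewrite -setIA (setIidPr XH) -setIDA; lia.
Qed.

(* Otherwise X :\: Y, X :&: Y and High :\: X are disjoint, and adding up
   [separated_count] for the three contradicts deg a < n/4. *)
Lemma separated_atom (X Y : {set T}) a : a \in Low -> separated X -> separated Y ->
  High :\: X != set0 -> X :&: Y = set0 \/ X \subset Y.
Proof.
move=> aL sX sY Z0.
have [D0|D0] := eqVneq (X :\: Y) set0; first by right; rewrite -setD_eq0 D0.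
have [I0|I0] := eqVneq (X :&: Y) set0; first by left.
have XH : X \subset High by case/andP: sX.
have sD := separatedD sX sY; have := separatedD sX sD.
rewrite setDDr setDv set0U => sI.
have := separated_count sD D0 aL; have := separated_count sI I0 aL.
have := separated_count (separatedD separated_high sX) Z0 aL.
have c1 (S : {set T}) : S \subset High -> #|N a :&: (High :\: S)| + #|N a :&: S| = #|N a :&: High|.
  by move=> SH; rewrite addnC -(cardsID S (N a :&: High)) -setIA (setIidPr SH) -setIDA.
have := c1 _ (subset_trans (subsetDl X Y) XH).
have := c1 _ (subset_trans (subsetIl X Y) XH).
have := c1 _ (subsetDl High X).
have := low_degree aL; have := card_low_high; have := cardsID X High; rewrite (setIidPr XH).
have := cardsID X (N a :&: High); rewrite -setIA (setIidPr XH) -setIDA.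
have := cardsID Y X; have := cardsID Y (N a :&: X); rewrite -setIA -setIDA.
move: aL; rewrite lowE; clear; lia.
Qed.

(** * HISTs from dominating sets *)

Lemma HIST_of_domination V0 t0 (Int0 I0 I : {set T}) k z :
  built e V0 t0 -> I0 \subset V0 ->
  (forall x, x \in V0 -> 0 < degree t0 x) ->
  (forall x, x \in V0 :\: I0 -> degree t0 x = 1) ->
  Int0 \subset I0 -> I0 :\: Int0 \subset High ->
  (forall x, x \in Int0 -> 3 <= degree t0 x) ->
  grows e High I0 I k ->
  (forall x, x \notin V0 :|: I -> exists2 y, y \in I & e y x) ->
  z \in I0 -> z \in High ->
  #|V0| + 2 * #|I0 :\: Int0| + 3 * k <= 3 * growth_cost #|undominated e High I0| + 8 ->
  has_HIST e.
Proof.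
move=> b0 sI0 pos leaf sInt JH deg3 g dom zI zH size_le.
apply: (HIST_of_growth e_sym e_irr b0 sI0 pos leaf sInt deg3 g dom) => x.
have [_ IH] := grows_sub g.
rewrite in_setD => /andP[xInt xI]; have xH : x \in High.
  have := subsetP IH _ xI; rewrite in_setU => /orP[xI0|//].
  by apply: (subsetP JH); rewrite in_setD xInt.
have cJ := grows_card Int0 g.
have cV : #|V0 :|: I| <= #|V0| + k.
  rewrite -(cardsID V0 (V0 :|: I)) (setIidPr (subsetUl _ _)) setDUl setDv set0U leq_add2l.
  apply: leq_trans (grows_card V0 g) _.
  by rewrite (_ : I0 :\: V0 = set0) ?cards0 //; apply/eqP; rewrite setD_eq0.
have und_lt : #|undominated e High I0| + degree e z < #|T|.
  have : undominated e High I0 \subset ~: (z |: N z).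
    apply/subsetP => y /undominatedP[_ yI h]; rewrite in_setC in_setU1 NE negb_or h // andbT.
    by apply: contraNneq yI => ->.
  move/subset_leq_card; have := cardsC (z |: N z).
  by rewrite cardsU1 NE e_irr /degree -/(N z); clear; lia.
(* [V0 :|: I] and the private leaves take up at most [#|V0| + 2 * #|I0 :\: Int0| + 3 * k]
   vertices. *)
have := growth_cost_budget n_ge (_ : _ <= 4 * degree e x) (_ : _ <= 4 * degree e z) und_lt.
rewrite -!highE => /(_ xH zH); move: cJ cV size_le; clear; lia.
Qed.

(** The centre [a] has degree 3 in the initial star, so it takes no private leaves and may be
    low. *)
Lemma HIST_of_star a z (Z Q I : {set T}) k :
  Q \subset N a -> #|Q| = 3 -> Z \subset Q -> Z \subset High ->
  z \in a |: Z -> z \in High ->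
  grows e High (a |: Z) I k ->
  (forall x, x \notin I -> exists2 y, y \in I & e y x) ->
  2 * #|Z| + 3 * k <= 3 * growth_cost #|undominated e High (a |: Z)| + 4 ->
  has_HIST e.
Proof.
move=> QN cQ ZQ ZH zI zH g dom size_le; have [t [b da dQ]] := built_star e_irr QN.
have aQ : a \notin Q by apply/negP => /(subsetP QN); rewrite NE e_irr.
have aZ : (a |: Z) :\: [set a] = Z.
  by rewrite setU1K //; apply: contra aQ; apply: (subsetP ZQ).
apply: (@HIST_of_domination _ _ [set a] _ _ k z b (setUS _ ZQ) _ _ _ _ _ g _ zI zH).
- by move=> x; rewrite in_setU1 => /orP[/eqP->|/dQ->//]; rewrite da cQ.
- by move=> x; rewrite in_setD !in_setU1 negb_or => /andP[/andP[/negbTE-> _] /dQ].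
- by rewrite sub1set setU11.
- by rewrite aZ.
- by move=> x /set1P->; rewrite da cQ.
- by move=> x; rewrite in_setU negb_or => /andP[_ /dom].
- by rewrite aZ cardsU1 aQ cQ; lia.
Qed.

Lemma undominated0 (C I : {set T}) x : undominated e C I = set0 -> x \in C -> x \notin I ->
  exists2 y, y \in I & e y x.
Proof.
move=> und0 xC xI; apply/exists_inP; apply: contraT; rewrite negb_exists_in => /forall_inP h.
have : x \in undominated e C I by apply/undominatedP.
by rewrite und0 in_set0.
Qed.

(** The exit condition of [dominate] can fail only for a separated set. *)
Lemma dominate_high (I0 : {set T}) :
  (forall x, x \in undominated e High I0 -> #|T| <= 4 * #|N x :&: High|.+1) ->
  (forall X : {set T}, separated X -> X != set0 -> ~~ (X \subset undominated e High I0)) ->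
  exists I k, [/\ grows e High I0 I k, undominated e High I = set0 &
    k <= growth_cost #|undominated e High I0|].
Proof.
move=> degU sepU; apply: dominate => // X XU X0.
have XH : X \subset High.
  by apply: subset_trans XU _; apply/subsetP => x /undominatedP[].
have [//|sX] := exit_or_separated XH; by have := sepU _ sX X0; rewrite XU.
Qed.

Lemma pick_triple a z : e a z -> 3 <= degree e a ->
  exists Q : {set T}, [/\ Q \subset N a, #|Q| = 3 & z \in Q].
Proof.
move=> az; rewrite /degree (cardsD1 z) in_nbhd az ltnS => /card_gt1P[x [y []]].
rewrite !in_setD1 !in_nbhd => /andP[xz ax] /andP[yz ay] xy; exists [set z; x; y].
split; last by rewrite !inE eqxx.
- by rewrite !subUset !sub1set !NE az ax ay.
- by rewrite -setUA cardsU1 cards2 !inE xy negb_or eq_sym xz eq_sym yz.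
Qed.

Lemma high_degree_ge3 x : x \in High -> 3 <= degree e x.
Proof. by rewrite highE => h; move: n_ge h; clear; lia. Qed.

(** * Existence, by cases on the low vertices *)

Lemma HIST_no_low : Low = set0 -> has_HIST e.
Proof.
move=> L0; have hT x : x \in High by rewrite highC L0 in_set0.
have [a _] : exists a, a \in T by apply/card_gt0P; apply: leq_trans n_ge.
have d3 := high_degree_ge3 (hT a).
have [z] : exists z, z \in N a by apply/card_gt0P; apply: leq_trans d3.
rewrite NE => az; have [Q [QN cQ _]] := pick_triple az d3.
have [x _|X sX /set0Pn[x xX]|I [k [g und0 k_le]]] := @dominate_high (a |: set0).
- rewrite (setIidPl _); last by apply/subsetP => y _.
  by have := hT x; rewrite highE /degree -/(N x); lia.
- apply/negP => XU; have aX : a \notin X.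
    apply/negP => /(subsetP XU)/undominatedP[_]; by rewrite setU11.
  have [u [v [uX vX uv]]] := exit_edge xX aX.
  have /separatedP[_ /(_ u v uX (hT v) uv)] := sX; by rewrite (negbTE vX).
apply: (HIST_of_star QN cQ (sub0set _) (sub0set _) (setU11 _ _) (hT a) g).
  by move=> x xI; apply: (undominated0 und0).
by rewrite cards0; lia.
Qed.

(** [a] dominates the low clique. As [a] is low, [z] joins the initial set to provide the high
    vertex required by the budget. *)
Lemma HIST_of_low_center a z : a \in Low -> 3 <= degree e a -> e a z -> z \in High ->
  (forall X, separated X -> X != set0 -> exists2 x, x \in X & e a x) -> has_HIST e.
Proof.
move=> aL da az zH sepX; have [Q [QN cQ zQ]] := pick_triple az da.
have [x /undominatedP[xH _ h]|X sX /sepX[//|x xX ax]|I [k [g und0 k_le]]] :=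
  @dominate_high (a |: [set z]).
- have xa : ~~ e x a by rewrite e_sym h ?setU11.
  by apply: leq_trans (high_degree aL xH xa) _; rewrite leq_mul2l leqnSn.
- apply/negP => /subsetP/(_ x xX)/undominatedP[_ _ /(_ a)].
  by rewrite setU11 ax => /(_ isT).
have [sI _] := grows_sub g.
apply: (HIST_of_star (z := z) QN cQ _ _ _ zH g); rewrite ?sub1set ?zQ //.
- by rewrite !inE eqxx orbT.
- move=> x xI; case xL: (x \in Low); last by apply: (undominated0 und0); rewrite ?highC ?xL.
  have aI : a \in I by rewrite (subsetP sI) ?setU11.
  exists a => //; rewrite low_clique //; by apply: contraNneq xI => <-.
- by rewrite cards1; lia.
Qed.

Lemma HIST_of_low_pendants a h : a \in Low -> e a h -> h \in High ->
  (forall b, b \in Low -> degree e b <= 2) ->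
  ~ (exists v w : T, [/\ pendant e v, e v w & degree e w = 2]) -> has_HIST e.
Proof.
move=> aL ah hH d2 nopend.
have a3 (x y t : T) : e a x -> e a y -> e a t -> x != y -> y != t -> t != x -> False.
  move=> ax ay at_ xy yt tx; have := d2 _ aL; rewrite leqNgt => /negP; apply.
  by apply/card_gt2P; exists x, y, t; rewrite !in_nbhd.
have hL x : x \in High -> x \in Low -> False by rewrite highC => /negP.
have [q] : exists q, q \in N h by apply/card_gt0P; apply: leq_trans (high_degree_ge3 hH).
rewrite NE => hq; have [Q [QN cQ _]] := pick_triple hq (high_degree_ge3 hH).
have neqHL x y : x \in High -> y \in Low -> x != y.
  by move=> xH yL; apply/eqP => xy; apply: (hL x) => //; rewrite xy.
have [x /undominatedP[xH xh hx]|X sX X0|I [k [g und0 k_le]]] := @dominate_high (h |: set0).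
- case xa: (e x a); last first.
    by apply: leq_trans (high_degree aL xH (negbT xa)) _; rewrite leq_mul2l leqnSn.
  (* The neighbours of [a] are just [h] and [x], so [a] is the only low neighbour of [x]. This loss
     of one is why [dominate] allows a successor in its degree condition. *)
  have sub : N x \subset a |: (N x :&: High).
    apply/subsetP => y; rewrite in_setU1 in_setI NE highC => xy; rewrite xy /=.
    case yL: (y \in Low); rewrite ?orbT // orbF; apply: contraT => ya.
    case: (@a3 h x y ah).
    + by rewrite e_sym.
    + by rewrite low_clique // eq_sym.
    + by apply: contraNneq xh => <-; rewrite setU11.
    + exact: neqHL.
    + by rewrite eq_sym neqHL.
  have := leq_trans (subset_leq_card sub) (leq_card_setU _ _); rewrite cards1.
  have := xH; rewrite highE /degree -/(N x); clear; lia.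
- apply/negP => XU; have hX : h \notin X.
    by apply/negP => /(subsetP XU)/undominatedP[_]; rewrite setU11.
  have := d2 _ aL; rewrite leqNgt => /negP; apply; apply: separated_degree sX X0 _ aL.
  by apply/set0Pn; exists h; rewrite in_setD hX.
(* [h] dominates [a]. A second low vertex [b] is not pendant, since its neighbour [a] has degree 2;
   so it has a high neighbour [h'], reached by at most one extra step. *)
have [I' [k' [g' sI k'_le dom]]] : exists I' k', [/\ grows e High (h |: set0) I' k',
    I \subset I', k' <= k.+1 &
    forall b, b \in Low -> exists2 y, y \in I' & e y b].
  have [sI _] := grows_sub g; have hI : h \in I by rewrite (subsetP sI) ?setU11.
  have ha : e h a by rewrite e_sym.
  have [[b [bL ba]]|aonly] : (exists b, b \in Low /\ b != a) \/ (forall b, b \in Low -> b = a).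
    have [|] := boolP [exists b in Low, b != a].
      by case/exists_inP=> b bL ba; left; exists b.
    rewrite negb_exists_in => /forall_inP h'; right => b /h'; by rewrite negbK => /eqP.
  - have ab : e a b by rewrite low_clique // eq_sym.
    have db : 1 < degree e b.
      rewrite ltnNge; apply/negP => db; case: nopend; exists b, a.
      have ba' : e b a by rewrite e_sym.
      split=> //; apply/eqP; rewrite eqn_leq ?db ?d2 //=.
        by apply/card_gt0P; exists a; rewrite in_nbhd.
      by apply/card_gt1P; exists h, b; rewrite !in_nbhd; split=> //; apply: neqHL.
    have [h' bh' h'a] : exists2 h', e b h' & h' != a.
      have /card_gt1P[u [v []]] := db; rewrite !in_nbhd => bu bv uv.
      have [ua|] := eqVneq u a; last by exists u.
      by exists v => //; rewrite -ua eq_sym.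
    have h'H : h' \in High.
      rewrite highC; apply/negP => h'L.
      case: (@a3 h b h' ah ab).
      + by rewrite low_clique // eq_sym.
      + exact: neqHL.
      + by apply: contraTneq bh' => <-; rewrite e_irr.
      + by rewrite eq_sym neqHL.
    have lowab c : c \in Low -> c != a -> c = b.
      move=> cL ca; apply/eqP; apply: contraT => cb.
      case: (@a3 h b c ah ab).
      + by rewrite low_clique // eq_sym.
      + exact: neqHL.
      + by rewrite eq_sym.
      + by rewrite eq_sym neqHL.
    have [h'I|h'I] := boolP (h' \in I).
      exists I, k; split=> // c cL; have [->|ca] := eqVneq c a; first by exists h.
      by exists h' => //; rewrite (lowab c) // e_sym.
    have [u uI uh'] := undominated0 und0 h'H h'I.
    exists (h' |: I), k.+1; split=> //; [exact: GrowS uI h'H uh'|exact: subsetUr|].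
    move=> c cL; have [->|ca] := eqVneq c a; first by exists h; rewrite ?inE ?hI ?orbT.
    by exists h'; rewrite ?setU11 // (lowab c) // e_sym.
  - by exists I, k; split=> // b /aonly ->; exists h.
apply: (HIST_of_star QN cQ (sub0set _) (sub0set _) (setU11 _ _) hH g').
  move=> x xI'; case xL: (x \in Low); first exact: dom.
  have [||y yI yx] := undominated0 und0 (_ : x \in High); rewrite ?highC ?xL //.
    by apply: contraNN xI'; apply: (subsetP sI).
  by exists y => //; apply: (subsetP sI).
by rewrite cards0; lia.
Qed.

(** By [separated_atom] the high vertices split into [X], missed by [a], and its complement [D],
    missed by [b]; together the two centres reach both. *)
Lemma HIST_of_two_low_centers a b z w (X Y : {set T}) : a \in Low -> b \in Low ->
  e a z -> z \in High -> separated X -> (forall x, x \in X -> ~~ e a x) ->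
  w \in X -> e b w -> separated Y -> Y != set0 -> (forall y, y \in Y -> ~~ e b y) ->
  has_HIST e.
Proof.
move=> aL bL az zH sX Xa wX bw sY /set0Pn[y0 y0Y] Yb.
have XH : X \subset High by case/andP: sX.
have YH : Y \subset High by case/andP: sY.
have hL x : x \in High -> x \in Low -> False by rewrite highC => /negP.
pose D := High :\: X; have sD : separated D := separatedD separated_high sX.
have zD : z \in D by rewrite in_setD zH andbT; apply: contraL az; apply: Xa.
have D0 : D != set0 by apply/set0Pn; exists z.
have X0 : X != set0 by apply/set0Pn; exists w.
have DX : High :\: D = X by rewrite setDDr setDv set0U; apply/setIidPr.
have XD0 : High :\: D != set0 by rewrite DX.
have coverH (S : {set T}) : S \subset High -> X :&: S = set0 -> D :&: S = set0 -> S = set0.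
  move=> SH XS DS; apply/setP => x; rewrite in_set0; apply/negP => xS.
  have [xX|xX] := boolP (x \in X).
    by have : x \in X :&: S; [rewrite in_setI xX | rewrite XS in_set0].
  by have : x \in D :&: S; [rewrite in_setI in_setD xX (subsetP SH) | rewrite DS in_set0].
have XY : X :&: Y = set0.
  case: (separated_atom aL sX sY D0) => // /subsetP/(_ w wX)/Yb; by rewrite bw.
have DY : D \subset Y.
  case: (separated_atom aL sD sY XD0) => // DY.
  by have := coverH _ YH XY DY => Y0; rewrite Y0 in_set0 in y0Y.
have Db x : x \in D -> ~~ e b x by move/(subsetP DY); apply: Yb.
have ab : a != b by apply: contraTneq az => ->; apply: Db.
(* Add [separated_count] for [D] at [a] and for [X] at [b]; in both the last term vanishes. *)
have L4 : 4 <= #|Low|.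
  have := separated_count sD D0 aL; have := separated_count sX X0 bL; rewrite DX.
  have -> : N a :&: X = set0.
    apply/setP => x; rewrite in_setI NE in_set0; apply/negP => /andP[ax xX].
    by have := Xa _ xX; rewrite ax.
  have -> : N b :&: (High :\: X) = set0.
    apply/setP => x; rewrite in_setI NE in_set0; apply/negP => /andP[bx xD].
    by have := Db _ xD; rewrite bx.
  have := cardsID X High; rewrite (setIidPr XH) -/D; have := card_low_high.
  rewrite !cards0; move: #|X| #|D| #|High| #|Low| #|T|; clear; lia.
have : 1 < #|Low :\ a :\ b|.
  move: L4; rewrite (cardsD1 a Low) aL (cardsD1 b) in_setD1 bL eq_sym ab.
  by move: #|_|; clear; lia.
case/card_gt1P=> c [d []]; rewrite !in_setD1 => /and3P[cb ca cL] /and3P[db da dL] cd.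
have neqHL x y : x \in High -> y \in Low -> x != y.
  by move=> xH yL; apply/eqP => xy; apply: (hL x) => //; rewrite xy.
have wH : w \in High by apply: (subsetP XH).
have wz : w != z by apply: contraTneq zD => <-; rewrite in_setD wX.
(* The initial tree is a double star: [a] is joined to [b], [c], [z], and [b] to [d], [w], so both
   centres have degree 3. *)
pose Q := [set b; c; z].
have QN : Q \subset nbhd e a.
  by rewrite !subUset !sub1set !in_nbhd az !low_clique // 1?eq_sym.
have cQ : #|Q| = 3.
  rewrite /Q -setUA cardsU1 cards2 in_set2 negb_or [b == c]eq_sym cb.
  by rewrite [b == z]eq_sym [c == z]eq_sym !neqHL.
have [t1 [b1 d1a d1Q]] := built_star e_irr QN.
pose A := [set d; w].
have bV : b \in a |: Q by rewrite !inE eqxx !orbT.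
have dA : [disjoint a |: Q & A].
  rewrite disjoint_sym disjoints_subset subUset !sub1set !in_setC !in_setU !in_set1 !negb_or.
  rewrite da db [d == c]eq_sym cd [d == z]eq_sym (neqHL z d) //=.
  by rewrite wz !neqHL.
have [|t0 [b0 d0V d0A]] := built_attach (f := fun _ => b) b1 dA.
  by move=> x; rewrite bV in_set2 => /orP[] /eqP-> //; rewrite low_clique // eq_sym.
have d1pos x : x \in a |: Q -> 0 < degree t1 x.
  by rewrite in_setU1 => /orP[/eqP->|/d1Q->//]; rewrite d1a cQ.
have [x /undominatedP[xH _ h]|S sS S0|I [k [g und0 k_le]]] := @dominate_high [set a; b; z].
- have xa : ~~ e x a by rewrite e_sym h // !inE eqxx.
  by apply: leq_trans (high_degree aL xH xa) _; rewrite leq_mul2l leqnSn.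
(* A nonempty separated set contains [X] or [D], hence [w], which [b] dominates, or [z]. *)
- apply/negP => /subsetP SU; move/eqP: S0; apply; apply: coverH.
  + by case/separatedP: sS.
  + case: (separated_atom aL sX sS D0) => // /subsetP/(_ w wX)/SU/undominatedP[_ _ /(_ b)].
    by rewrite !inE eqxx !orbT bw => /(_ isT).
  + case: (separated_atom aL sD sS XD0) => // /subsetP/(_ z zD)/SU/undominatedP[_].
    by rewrite !inE eqxx !orbT.
have [sI _] := grows_sub g.
have aI : a \in I by rewrite (subsetP sI) // !inE eqxx.
have JZ : [set a; b; z] :\: [set a; b] \subset [set z] by rewrite subDset subxx.
apply: (@HIST_of_domination _ t0 [set a; b] [set a; b; z] I k z b0).
- by apply/subsetP => x; rewrite !inE => /orP[/orP[]|] ->; rewrite ?orbT.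
- move=> x; rewrite in_setU => /orP[xV|/d0A->//].
  by rewrite d0V // ltn_addr // d1pos.
- move=> x; rewrite in_setD => /andP[xI0]; rewrite in_setU => /orP[xV|/d0A//].
  have xb : b != x by apply: contraNneq xI0 => <-; rewrite !inE eqxx orbT.
  rewrite d0V // (_ : [set _ in A | _] = set0) ?cards0 ?addn0; last first.
    by apply/setP => y; rewrite !inE (negbTE xb) andbF.
  apply: d1Q; move: xV; rewrite in_setU1 => /orP[/eqP xa|//].
  by move: xI0; rewrite xa !inE eqxx.
- exact: subsetUl.
- by apply: subset_trans JZ _; rewrite sub1set.
- move=> x; rewrite in_set2 => /orP[/eqP->|/eqP->].
    by rewrite d0V ?setU11 // d1a cQ.
  rewrite d0V // d1Q; last by rewrite !inE eqxx.
  rewrite (_ : [set _ in A | _] = A) ?cards2 ?(eq_sym d) ?neqHL //.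
  by apply/setP => y; rewrite !inE eqxx andbT.
- exact: g.
- move=> x; rewrite in_setU negb_or => /andP[_ xI].
  case xL: (x \in Low); last by apply: (undominated0 und0); rewrite ?highC ?xL.
  by exists a => //; rewrite low_clique //; apply: contraNneq xI => <-.
- by rewrite !inE eqxx orbT.
- exact: zH.
have := subset_leq_card JZ; rewrite cards1.
have := leq_card_setU (a |: Q) A => -[+ _].
have -> : #|a |: Q| = 4.
  by rewrite cardsU1 cQ; have -> : a \notin Q by apply/negP => /(subsetP QN); rewrite in_nbhd e_irr.
have : #|A| <= 2 by rewrite cards2; case: (_ != _).
by move: k_le; clear; lia.
Qed.

Lemma HIST_of_no_pendant :
  ~ (exists v w : T, [/\ pendant e v, e v w & degree e w = 2]) -> has_HIST e.
Proof.
move=> nopend; have [L0|[x0 x0L]] := set_0Vmem Low; first exact: HIST_no_low.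
have [h0 h0L] : exists h, h \notin Low.
  have : 0 < #|High|.
    have := low_degree x0L; have := card_low_high; move: x0L; rewrite lowE; move: n_ge; clear; lia.
  by case/card_gt0P=> h; rewrite highC; exists h.
have [a0 [h [a0L hL a0h]]] := exit_edge x0L h0L; rewrite -highC in hL.
have [/exists_inP[b0 b0L db0]|] := boolP [exists b in Low, 3 <= degree e b]; last first.
  rewrite negb_exists_in => /forall_inP d2.
  by apply: (HIST_of_low_pendants a0L a0h hL) => // b bL; rewrite leqNgt d2.
have [a [z [aL da az zH]]] : exists a z, [/\ a \in Low, 3 <= degree e a, e a z & z \in High].
  have [N0|[z]] := set_0Vmem (N b0 :&: High); last first.
    by rewrite in_setI NE => /andP[bz zH]; exists b0, z.
  (* If [b0] has no high neighbour, its degree yields at least four low vertices, so [a0] has degree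
     at least 3. *)
  exists a0, h; split=> //.
  have := low_degree b0L; have := low_degree a0L; rewrite N0 cards0.
  by move: db0; clear; lia.
pose meets c := [forall X : {set T}, (separated X && (X != set0)) ==> [exists x in X, e c x]].
have meetsP c : meets c -> forall X, separated X -> X != set0 -> exists2 x, x \in X & e c x.
  by move=> /forallP h' X sX X0; apply/exists_inP; have /implyP := h' X; rewrite sX X0 => ->.
have meetsN c : ~~ meets c ->
    exists X, [/\ separated X, X != set0 & forall x, x \in X -> ~~ e c x].
  rewrite negb_forall => /existsP[X]; rewrite negb_imply => /andP[/andP[sX X0]].
  by rewrite negb_exists_in => /forall_inP h'; exists X.
have [/meetsP ma|/meetsN[X [sX X0 Xa]]] := boolP (meets a).
  exact: HIST_of_low_center aL da az zH ma.
have zX : z \notin X by apply: contraL az; apply: Xa.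
have [w0 w0X] := set0Pn _ X0.
(* An edge leaving the separated set [X] can only end in a low vertex [b]. *)
have [w [b [wX bX wb]]] := exit_edge w0X zX.
have /separatedP[XH hX] := sX.
have bL : b \in Low.
  by apply: contraNT bX; rewrite -highC => bH; apply: (hX w).
have bw : e b w by rewrite e_sym.
have [/meetsP mb|/meetsN[Y [sY Y0 Yb]]] := boolP (meets b).
  apply: (HIST_of_low_center bL _ bw (subsetP XH _ wX) mb).
  by apply: separated_degree sX X0 _ bL; apply/set0Pn; exists z; rewrite in_setD zX.
exact: HIST_of_two_low_centers aL bL az zH sX Xa wX bw sY Y0 Yb.
Qed.

End Structure.

(** * Necessity of the condition *)

Lemma no_pendant_of_HIST (T : finType) (e : rel T) : symmetric e -> irreflexive e ->
  2 < #|T| -> has_HIST e ->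
  ~ (exists v w : T, [/\ pendant e v, e v w & degree e w = 2]).
Proof.
move=> e_sym e_irr n3 [t [[[[t_sym t_irr] t_conn _] sub] deg2]] [v [w [pv evw dw]]].
have nv : nbhd e v = [set w].
  by have /eqP/cards1P[x nx] := pv; have := evw; rewrite -in_nbhd nx inE => /eqP->.
have sN x : nbhd t x \subset nbhd e x by apply/subsetP => y; rewrite !inE; apply: sub.
have vw : v != w by apply: contraTneq evw => ->; rewrite e_irr.
have tv y : t v y -> y = w.
  by move/sub; rewrite -in_nbhd nv inE => /eqP.
have exit (S : {set T}) x y : x \in S -> y \notin S ->
    exists u u', [/\ u \in S, u' \notin S & t u u'].
  exact: (exit_edge t_sym t_conn).
have twv : t v w.
  have [||u [u' [/set1P-> _ tvu]]] := exit [set v] v w; rewrite ?inE ?eqxx // 1?eq_sym //.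
  by rewrite -(tv _ tvu).
have [y] : exists y, y \in ~: [set v; w].
  by apply/card_gt0P; have := cardsC [set v; w]; rewrite cards2 vw; move: n3; clear; lia.
rewrite in_setC => yS; have [|u [u' [+ u'S tuu']]] := exit [set v; w] v y _ yS.
  by rewrite !inE eqxx.
rewrite in_set2 => /orP[/eqP uv|/eqP uw].
  by move: u'S; rewrite uv in tuu'; rewrite (tv _ tuu') !inE eqxx orbT.
(* The tree contains [v w] and, as n > 2, a further edge at [w]; so [w] has degree 2 in the tree as
   well. *)
case: (deg2 w); apply/eqP; rewrite eqn_leq; apply/andP; split.
  by rewrite -dw subset_leq_card.
apply/card_gt1P; exists v, u'; rewrite !in_nbhd t_sym twv -uw tuu'; split=> //.
by apply: contraNneq u'S => <-; rewrite !inE eqxx.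
Qed.

Import GRing.Theory Num.Theory.

Theorem corollary1p4 (T : finType) (e : rel T)
    (e_simple : simple_graph e) (e_connected : connected_graph e)
    (n_ge : 270 <= #|T|) (NC_bound : NC_ge e (#|T|%:R / 2%:R)%R) :
  has_HIST e <->
  ~ (exists v w : T, [/\ pendant e v, e v w & degree e w = 2]).
Proof.
have [e_sym e_irr] := e_simple; split.
  by apply: no_pendant_of_HIST => //; apply: leq_trans n_ge.
apply: HIST_of_no_pendant => // u v uv euv.
have := NC_bound u v uv euv.
rewrite ler_pdivrMr ?ltr0n // -natrM ler_nat; by rewrite mulnC.
Qed.
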